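(* Let $G=(V,E)$ be a finite graph with at least one vertex and $k>0$ an integer. Then exactly one of the following holds: (i) $G$ has an $\mathcal F_k^{(2)}$-tangle of $S_k$; (ii) $G$ has an $S_k$-tree over $\mathcal F_k^{(2)}$.
   Context: An (oriented vertex) separation of $G$ is a pair $(A,B)$ of (possibly empty) subsets of $V$ with $A\cup B=V$ and no edge between $A\setminus B$ and $B\setminus A$; $\vec U$ is the set of these, ordered by $(A,B)\le(C,D)$ iff $A\subseteq C$ and $B\supseteq D$, inverse $(B,A)$; $\{A,B\}$ is the unoriented separation, of order $|A\cap B|$. $\vec S_k$: oriented separations of order $<k$; $S_k$: unoriented ones. An orientation of $S_k$ is a set $O\subseteq\vec S_k$ containing exactly one of $(A,B),(B,A)$ for each $\{A,B\}\in S_k$; it is consistent if there are no $(A,B),(C,D)\in\vec S_k$ with $\{A,B\}\ne\{C,D\}$, $(A,B)<(C,D)$, $(B,A)\in O$, $(C,D)\in O$. A star is a set $\sigma$ of separations with $(A,B)\ne(B,A)$ for each element and $(A,B)\le(D,C)$ for distinct $(A,B),(C,D)\in\sigma$. $\mathcal F_k$ is the set of stars $\{(A_i,B_i):i=0,\dots,n\}\subseteq\vec U$ with $|\bigcap_{i=0}^nB_i|<k$ (intersection $=V$ for the empty star), and $\mathcal F_k^{(2)}=\{\sigma\in\mathcal F_k:|\sigma|\le2\}$. An $\mathcal F_k^{(2)}$-tangle of $S_k$ is a consistent orientation of $S_k$ with no subset in $\mathcal F_k^{(2)}$. An $S_k$-tree over $\mathcal F_k^{(2)}$ is a pair $(T,\alpha)$,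 $T$ a finite tree with at least one node, $\alpha$ assigning to each ordered pair $(x,y)$ with $xy\in E(T)$ an element $\alpha(x,y)\in\vec S_k$ with $\alpha(y,x)$ the inverse of $\alpha(x,y)$ and $\{\alpha(x,t):xt\in E(T)\}\in\mathcal F_k^{(2)}$ for every node $t$. *)

(* Defs.v *)
From mathcomp Require Import all_boot.

Set Implicit Arguments.
Unset Strict Implicit.
Unset Printing Implicit Defensive.

Definition simple_graph (V : finType) (e : rel V) : Prop :=
  symmetric e /\ irreflexive e.

Definition acyclic (T : finType) (e : rel T) : Prop :=
  forall c : seq T, 2 < size c -> ~~ ucycleb e c.

Definition is_tree (T : finType) (e : rel T) : Prop :=
  [/\ simple_graph e, 0 < #|T|, forall x y : T, connect e x y & acyclic e].

Definition sep (V : finType) : finType := ({set V} * {set V})%type.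

Definition rev_sep (V : finType) (s : sep V) : sep V := (s.2, s.1).

Definition unoriented (V : finType) (s : sep V) : {set {set V}} :=
  [set s.1; s.2].

Definition order_sep (V : finType) (s : sep V) : nat := #|s.1 :&: s.2|.

Definition le_sep (V : finType) (r s : sep V) : bool :=
  (r.1 \subset s.1) && (s.2 \subset r.2).

Definition lt_sep (V : finType) (r s : sep V) : bool :=
  (r != s) && le_sep r s.

Definition separation (V : finType) (e : rel V) (s : sep V) : bool :=
  (s.1 :|: s.2 == [set: V]) &&
  [forall x in s.1 :\: s.2, forall y in s.2 :\: s.1, ~~ e x y].

Definition vecU (V : finType) (e : rel V) : {set sep V} :=
  [set s | separation e s].

Definition vecS (V : finType) (e : rel V) (k : nat) : {set sep V} :=
  [set s in vecU e | order_sep s < k].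

(* Counting in [set s; rev_sep s] rather than using an exclusive or: the
   degenerate separation (V, V), which equals its own inverse, has a single
   orientation, and this orientation must then belong to O. *)
Definition orientation (V : finType) (e : rel V) (k : nat) (O : {set sep V})
    : Prop :=
  O \subset vecS e k /\
  forall s, s \in vecS e k -> #|O :&: [set s; rev_sep s]| = 1.

Definition consistent (V : finType) (e : rel V) (k : nat) (O : {set sep V})
    : Prop :=
  ~ exists r s : sep V,
      [/\ r \in vecS e k, s \in vecS e k, unoriented r != unoriented s
        & [/\ lt_sep r s, rev_sep r \in O & s \in O]].

Definition star (V : finType) (sigma : {set sep V}) : Prop :=
  (forall s, s \in sigma -> s != rev_sep s) /\
  (forall r s, r \in sigma -> s \in sigma -> r != s -> le_sep r (rev_sep s)).

Definition Fk (V : finType) (e : rel V) (k : nat) (sigma : {set sep V})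
    : Prop :=
  [/\ sigma \subset vecU e, star sigma & #|\bigcap_(s in sigma) s.2| < k].

Definition Fk2 (V : finType) (e : rel V) (k : nat) (sigma : {set sep V})
    : Prop :=
  Fk e k sigma /\ #|sigma| <= 2.

Definition tangle (V : finType) (e : rel V) (k : nat)
    (F : {set sep V} -> Prop) (O : {set sep V}) : Prop :=
  [/\ orientation e k O, consistent e k O
    & forall sigma : {set sep V}, sigma \subset O -> ~ F sigma].

(* The values of alpha on pairs that are not edges of T are unconstrained. *)
Definition Sk_tree (V : finType) (e : rel V) (k : nat)
    (F : {set sep V} -> Prop)
    (T : finType) (t : rel T) (alpha : T -> T -> sep V) : Prop :=
  [/\ is_tree t,
      forall x y, t x y -> alpha x y \in vecS e k,
      forall x y, t x y -> alpha y x = rev_sep (alpha x y)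
    & forall y : T, F [set alpha x y | x : T & t x y]].

(* Main.v *)
Require Import Defs.
From mathcomp Require Import all_boot.

(** Suppose [#|V| >= k]. For separations [s <= t] of order [< k], say that [t]
    can follow [s] if the "bag" [s.2 :&: t.1] has fewer than [k] elements; the
    bag is the separator of the separation [(t.1, s.2)], so submodularity
    applies to bags as it does to separations. Call [s] small if [#|s.1| < k].
    A chain leading from a small separation to the inverse of a small one is a
    path-shaped tree over [Fk2]. If there is none, take a down-closed set [X]
    containing all small separations, maximal with the property that no chain
    leads from [X] to the inverse of an element of [X]. If [X] misses both
    orientations of [s], pick [r <= s] and [r' <= rev_sep s] minimal outside
    [X]; by maximality there are chains from [r] and from [r'] to inverses of
    elements of [X]. Shifting both onto a separation [w] of minimum order
    between [r] and [rev_sep r'] gives two chains that can be glued at [w], a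
    contradiction. Hence [X] orients everything, and it is a tangle.

    Conversely, a tangle orients the edges of a tree over [Fk2] so that every
    node has an outgoing edge, and in a finite tree some edge would then be
    oriented both ways. *)

Set Implicit Arguments.
Unset Strict Implicit.
Unset Printing Implicit Defensive.

(** * Lattice operations on separations and submodularity of the order *)

Section Separations.

Variable V : finType.
Implicit Types r s t u w : sep V.

Definition meet_sep s t : sep V := (s.1 :&: t.1, s.2 :|: t.2).
Definition join_sep s t : sep V := (s.1 :|: t.1, s.2 :&: t.2).

Lemma rev_sepK : involutive (@rev_sep V).
Proof. by case. Qed.

Lemma le_sep_refl s : le_sep s s.
Proof. by rewrite /le_sep !subxx. Qed.

Lemma le_sep_trans s r t : le_sep r s -> le_sep s t -> le_sep r t.
Proof.
move=> /andP[r1 r2] /andP[s1 s2].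
by rewrite /le_sep (subset_trans r1 s1) (subset_trans s2 r2).
Qed.

Lemma le_rev_sep s t : le_sep (rev_sep s) (rev_sep t) = le_sep t s.
Proof. by rewrite /le_sep andbC. Qed.

Lemma order_rev_sep s : order_sep (rev_sep s) = order_sep s.
Proof. by rewrite /order_sep setIC. Qed.

Lemma rev_join_sep s t :
  rev_sep (join_sep s t) = meet_sep (rev_sep s) (rev_sep t).
Proof. by []. Qed.

Lemma le_meetl s t : le_sep (meet_sep s t) s.
Proof. by rewrite /le_sep subsetIl subsetUl. Qed.

Lemma le_meetr s t : le_sep (meet_sep s t) t.
Proof. by rewrite /le_sep subsetIr subsetUr. Qed.

Lemma le_meet r s t : le_sep r s -> le_sep r t -> le_sep r (meet_sep s t).
Proof.
by move=> /andP[? ?] /andP[? ?]; apply/andP; rewrite subsetI subUset; split; apply/andP.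
Qed.

Lemma join_mono s t w : le_sep s t -> le_sep (join_sep s w) (join_sep t w).
Proof. by move=> /andP[? ?]; rewrite /le_sep setSU ?setSI. Qed.

Lemma join_sep_r s t : le_sep s t -> join_sep s t = t.
Proof.
by case: t => A B /andP[/= /setUidPr sA /setIidPr sB]; rewrite /join_sep /= sA sB.
Qed.

Lemma order_submod s t :
  order_sep (meet_sep s t) + order_sep (join_sep s t)
    <= order_sep s + order_sep t.
Proof.
(* Both sums of separator sizes become union plus intersection. The union and the intersection of
   the separators on the left lie inside those on the right. *)
rewrite /order_sep -[X in X <= _]cardsUI -[X in _ <= X]cardsUI.
by apply: leq_add; apply/subset_leq_card/subsetP=> x; rewrite !inE;
  case: (x \in s.1); case: (x \in s.2); case: (x \in t.1); case: (x \in t.2).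
Qed.

Lemma minimal_sep (P : pred (sep V)) s :
  P s -> exists r, [/\ P r, le_sep r s &
    forall v, P v -> le_sep v r -> v = r].
Proof.
move=> Ps; pose Q := [pred r | P r && le_sep r s].
have Qs : Q s by rewrite /= Ps le_sep_refl.
(* This measure grows strictly along [le_sep], so a minimiser of it is minimal in the order. *)
case: (arg_minnP (fun r => #|r.1| + #|~: r.2|) Qs) => r /andP[Pr rs] r_min.
exists r; split=> // v Pv vr.
have := r_min v; rewrite /= Pv (le_sep_trans vr rs) => /(_ isT).
case: r v vr {Pr Pv rs r_min} => [A B] [C D] /andP[/= CA BD] le_meas.
have le1 := subset_leq_card CA.
have DB : ~: D \subset ~: B by rewrite setCS.
have le2 := subset_leq_card DB.
have eqA : C = A.
  apply/eqP; rewrite eqEcard CA -(leq_add2r #|~: B|).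
  by rewrite (leq_trans le_meas) // leq_add2l.
congr pair => //; apply: setC_inj; apply/eqP; rewrite eqEcard DB /=.
by rewrite -(leq_add2l #|A|) (leq_trans le_meas) // leq_add2r.
Qed.

(** * Separations of a fixed graph *)

Section Graph.

Variables (e : rel V) (k : nat).
Hypothesis e_sym : symmetric e.

Local Notation S := (vecS e k).

(** Once the two sides cover [V], lying in [s.1 :\: s.2] just means lying outside [s.2]. Both
    conditions thus become pointwise disjunctions, suited to case analysis. *)
Lemma separationP s :
  reflect ((forall x, (x \in s.1) || (x \in s.2)) /\
           (forall x y, e x y -> (x \in s.2) || (y \in s.1)))
          (separation e s).
Proof.
apply: (iffP andP) => [[/eqP cov /forall_inP noe]|[cov noe]].
  have c x : (x \in s.1) || (x \in s.2) by rewrite -in_setU cov inE.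
  split=> // x y exy; apply: contraT; rewrite negb_or => /andP[xB yA].
  have xAB : x \in s.1 :\: s.2.
    by move: (c x); rewrite inE xB (negPf xB) orbF.
  have yBA : y \in s.2 :\: s.1.
    by move: (c y); rewrite inE yA (negPf yA).
  by move/forall_inP: (noe x xAB) => /(_ y yBA); rewrite exy.
split; first by apply/eqP/setP=> x; rewrite !inE cov.
apply/forall_inP=> x; rewrite inE => /andP[xB _].
apply/forall_inP=> y; rewrite inE => /andP[yA _].
by apply/negP => /noe; rewrite (negPf xB) (negPf yA).
Qed.

Lemma in_vecS s : (s \in S) = separation e s && (order_sep s < k).
Proof. by rewrite !inE. Qed.

Lemma separation_rev s : separation e s -> separation e (rev_sep s).
Proof.
move=> /separationP[cov noe]; apply/separationP; split=> [x|x y]; rewrite orbC //.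
by rewrite e_sym => /noe.
Qed.

Lemma vecS_rev s : (rev_sep s \in S) = (s \in S).
Proof.
rewrite !in_vecS order_rev_sep; congr andb.
by apply/idP/idP => /separation_rev; rewrite ?rev_sepK.
Qed.

Lemma separation_meet s t :
  separation e s -> separation e t -> separation e (meet_sep s t).
Proof.
move=> /separationP[cs ns] /separationP[ct nt]; apply/separationP.
split=> [x|x y exy]; rewrite !inE.
  by have := cs x; have := ct x; case: (x \in s.2); case: (x \in t.2);
    rewrite ?orbT ?orbF // => -> ->.
by have := ns x y exy; have := nt x y exy; case: (x \in s.2); case: (x \in t.2);
  rewrite //= => -> ->.
Qed.

Lemma separation_join s t :
  separation e s -> separation e t -> separation e (join_sep s t).
Proof.
move=> ss st; rewrite -[join_sep _ _]rev_sepK rev_join_sep.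
by apply/separation_rev/separation_meet; apply: separation_rev.
Qed.

Lemma separation_bag s t :
  separation e s -> le_sep s t -> separation e (t.1, s.2).
Proof.
move=> /separationP[cs ns] /andP[/subsetP st _]; apply/separationP.
split=> [x|x y exy] /=.
  by case/orP: (cs x) => [/st ->|->]; rewrite ?orbT.
by case/orP: (ns x y exy) => [->|/st ->]; rewrite ?orbT.
Qed.

(** * Chains of separations, their reversal and their shifts *)

Definition follows : rel (sep V) :=
  [rel s t | [&& s \in S, t \in S, le_sep s t & #|s.2 :&: t.1| < k]].

Lemma follows_rev s t : follows (rev_sep t) (rev_sep s) = follows s t.
Proof. by rewrite /follows /= !vecS_rev le_rev_sep andbCA setIC. Qed.

Lemma connect_follows_rev s t :
  connect follows s t -> connect follows (rev_sep t) (rev_sep s).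
Proof.
move=> /connectP[p]; elim: p s => [|u p IHp] s /= => [_ ->|]; first exact: connect0.
case/andP=> su up /(IHp _ up) ut.
by apply: connect_trans ut (connect1 _); rewrite follows_rev.
Qed.

Definition linked_min r w :=
  forall v, v \in S -> le_sep r v -> le_sep v w -> order_sep w <= order_sep v.

(** The meet of [u] and [w] lies between [r] and [w], so its order is at least that of [w]. By
    submodularity the join then has order at most that of [u]. *)
Lemma join_linked r w u : w \in S -> le_sep r w -> linked_min r w ->
  u \in S -> le_sep r u -> join_sep u w \in S.
Proof.
rewrite !in_vecS => /andP[sw ow] rw w_min /andP[su ou] ru.
rewrite separation_join //=; apply: leq_ltn_trans ou.
rewrite -(leq_add2l (order_sep w)) [X in _ <= X]addnC.
apply: leq_trans (order_submod u w); rewrite leq_add2r leqNgt; apply/negP => lt_uw.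
have /w_min : meet_sep u w \in S by rewrite in_vecS separation_meet ?(ltn_trans lt_uw).
by rewrite le_meetr le_meet // leqNgt lt_uw => /(_ isT isT).
Qed.

(** The new bag is the separator of the join of [(t.1, s.2)] with [w]. As [(t.1, s.2)] is itself a
    separation above [r], [join_linked] bounds the bag too. *)
Lemma follows_join r w s t : w \in S -> le_sep r w -> linked_min r w ->
  le_sep r s -> follows s t -> follows (join_sep s w) (join_sep t w).
Proof.
move=> Sw rw w_min rs /and4P[Ss St st bag].
have rt := le_sep_trans rs st.
apply/and4P; split; try exact: join_linked w_min _ _; first exact: join_mono.
have /(join_linked Sw rw w_min) : (t.1, s.2) \in S.
  rewrite in_vecS /order_sep setIC bag andbT separation_bag //.
  by move: Ss; rewrite in_vecS => /andP[].
rewrite in_vecS /order_sep setIC => H.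
case/andP: rs rt => _ rs /andP[rt _].
by move: H; rewrite /le_sep /= rs rt => /(_ isT) /andP[].
Qed.

Lemma connect_follows_join r w s t : w \in S -> le_sep r w -> linked_min r w ->
  le_sep r s -> connect follows s t ->
  connect follows (join_sep s w) (join_sep t w) /\ le_sep r t.
Proof.
move=> Sw rw w_min rs /connectP[p].
elim: p s rs => [|u p IHp] s rs /= => [_ ->|]; first by rewrite connect0.
case/andP=> su up def_t.
have ru : le_sep r u by apply: le_sep_trans rs _; case/and4P: su.
have [ut rt] := IHp u ru up def_t; split=> //.
exact: connect_trans (connect1 (follows_join Sw rw w_min rs su)) ut.
Qed.

(** * Maximal unlinked down-closed sets are tangles *)

Definition unlinked (X : {set sep V}) :=
  [forall x in X, forall y in X, ~~ connect follows x (rev_sep y)].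

Definition down_closed (X : {set sep V}) :=
  [forall x in X, forall y in S, le_sep y x ==> (y \in X)].

Definition small_seps := [set s in S | #|s.1| < k].

Definition pretangle (X : {set sep V}) :=
  [&& X \subset S, small_seps \subset X, down_closed X & unlinked X].

Lemma down_closedP (X : {set sep V}) :
  reflect (forall x y, x \in X -> y \in S -> le_sep y x -> y \in X)
          (down_closed X).
Proof.
apply: (iffP forall_inP) => [dX x y xX yS yx|dX x xX].
  by move/forall_inP: (dX x xX) => /(_ y yS)/implyP; apply.
by apply/forall_inP=> y yS; apply/implyP; apply: dX.
Qed.

Lemma unlinkedPn (X : {set sep V}) :
  reflect (exists x y, [/\ x \in X, y \in X & connect follows x (rev_sep y)])
          (~~ unlinked X).
Proof.
rewrite negb_forall_in; apply: (iffP exists_inP) => [[x xX]|[x [y [xX yX xy]]]].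
  by rewrite negb_forall_in => /exists_inP[y yX /negPn xy]; exists x, y.
by exists x => //; rewrite negb_forall_in; apply/exists_inP; exists y; rewrite ?negbK.
Qed.

Lemma small_down_closed : down_closed small_seps.
Proof.
apply/down_closedP => x y; rewrite inE => /andP[_ x_small] Sy /andP[yx _].
by rewrite inE Sy (leq_ltn_trans (subset_leq_card yx)).
Qed.

(** Joined with [w], the chain starts at [w], because [r <= w], and ends at the inverse of
    [meet_sep y (rev_sep w)]. That meet lies below [y], so it is in [X] whenever [y] is. *)
Lemma shift_chain (X : {set sep V}) r w y : pretangle X -> r \in S ->
  w \in S -> le_sep r w -> linked_min r w ->
  y \in r |: X -> connect follows r (rev_sep y) ->
  exists2 z, z \in X & connect follows w (rev_sep z).
Proof.
case/and4P=> XS smX /down_closedP dX _ Sr Sw rw w_min yX ry.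
have [wz rz] := connect_follows_join Sw rw w_min (le_sep_refl r) ry.
exists (rev_sep (join_sep (rev_sep y) w)); last by rewrite rev_sepK -{1}(join_sep_r rw).
have Sy : y \in S by case/setU1P: yX => [->|/(subsetP XS)].
have Sz : rev_sep (join_sep (rev_sep y) w) \in S.
  by rewrite vecS_rev (join_linked Sw rw w_min) // vecS_rev.
case/setU1P: yX => [def_y|yX]; last first.
  by apply: (dX y) => //; rewrite rev_join_sep rev_sepK le_meetl.
(* Here [y = r <= w], so the shifted separation has its first side inside the
   separator of [w] and is small. *)
subst y; apply: (subsetP smX); rewrite inE Sz /=.
move: Sw; rewrite in_vecS => /andP[_]; apply: leq_ltn_trans.
by apply/subset_leq_card; rewrite setSI //; case/andP: rw.
Qed.

(** Minimality of [r] keeps [r |: X] down-closed, so by maximality of [X] it must be linked. As [X]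
    is not, one end of the linking chain comes from [r]; reversing the chain if necessary makes it
    start there. *)
Lemma maximal_chain (X : {set sep V}) r : maxset pretangle X ->
  r \in S -> r \notin X ->
  (forall v, v \in S -> v \notin X -> le_sep v r -> v = r) ->
  exists2 y, y \in r |: X & connect follows r (rev_sep y).
Proof.
case/maxsetP=> /and4P[XS smX dX uX] X_max Sr rX r_min.
have /unlinkedPn[x [y [xrX yrX xy]]] : ~~ unlinked (r |: X).
  apply: contra rX => uY.
  rewrite -(X_max (r |: X)) ?setU11 ?subsetUr //; apply/and4P; split=> //.
  - by rewrite subUset sub1set Sr.
  - by rewrite (subset_trans smX) ?subsetUr.
  apply/down_closedP => x y /setU1P[->|xX] Sy yx.
    by case: (boolP (y \in X)) => [|/r_min <-//]; rewrite !inE ?eqxx // => ->; rewrite orbT.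
  by rewrite !inE (down_closedP _ dX x y) ?orbT.
case/setU1P: (xrX) xy => [->|xX]; first by exists y.
case/setU1P: (yrX) => [->|yX] xy.
  by exists x => //; rewrite -[r]rev_sepK; apply: connect_follows_rev.
by move/forall_inP: uX => /(_ x xX)/forall_inP/(_ y yX); rewrite xy.
Qed.

Lemma maximal_orients (X : {set sep V}) s : maxset pretangle X ->
  s \in S -> (s \in X) || (rev_sep s \in X).
Proof.
move=> X_max Ss; apply: contraT; rewrite negb_or => /andP[sX rsX].
have min_out u : u \in S -> u \notin X -> exists r, [/\ r \in S, r \notin X, le_sep r u
    & forall v, v \in S -> v \notin X -> le_sep v r -> v = r].
  move=> Su uX; have [|r [/andP[Sr rX] ru r_min]] :=
    @minimal_sep [pred v | (v \in S) && (v \notin X)] u; first by rewrite /= Su.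
  by exists r; split=> // v Sv vX; apply: r_min; rewrite /= Sv.
have [r [Sr rX rs r_min]] := min_out s Ss sX.
have [|r' [Sr' rX' rs' r_min']] := min_out (rev_sep s) _ rsX; first by rewrite vecS_rev.
pose Q := [pred v | [&& v \in S, le_sep r v & le_sep v (rev_sep r')]].
have Qs : Q s by rewrite /= Ss rs -[s]rev_sepK le_rev_sep.
have [w /and3P[Sw rw wr'] w_min] := arg_minnP (@order_sep V) Qs.
have X_pre : pretangle X by case/maxsetP: X_max.
have [y yX ry] := maximal_chain X_max Sr rX r_min.
have [y' yX' ry'] := maximal_chain X_max Sr' rX' r_min'.
have [|z zX wz] := shift_chain X_pre Sr Sw rw _ yX ry.
  by move=> v Sv rv vw; apply: w_min; rewrite /= Sv rv (le_sep_trans vw).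
(* The choice of [w] is symmetric under reversal: [rev_sep w] has minimum order between [r'] and
   [rev_sep r]. The second chain is therefore shifted onto [rev_sep w] and then reversed to end at
   [w], where the first one begins. *)
have r'w : le_sep r' (rev_sep w) by rewrite -[r']rev_sepK le_rev_sep.
have [||z' zX' wz'] := shift_chain X_pre Sr' _ r'w _ yX' ry'; first by rewrite vecS_rev.
  move=> v Sv rv vw; rewrite order_rev_sep -(order_rev_sep v).
  apply: w_min; rewrite /= vecS_rev Sv le_rev_sep rv andbT.
  by apply: le_sep_trans rw _; rewrite -[w]rev_sepK le_rev_sep.
have z'w := connect_follows_rev wz'; rewrite !rev_sepK in z'w.
case/and4P: X_pre => _ _ _ /forall_inP/(_ z' zX')/forall_inP/(_ z zX).
by rewrite (connect_trans z'w wz).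
Qed.

Lemma maximal_tangle (X : {set sep V}) : k <= #|V| ->
  maxset pretangle X -> tangle e k (Fk2 e k) X.
Proof.
move=> kV X_max; have [/and4P[XS smX /down_closedP dX uX] _] := maxsetP X_max.
have no_chain x y : x \in X -> y \in X -> connect follows x (rev_sep y) -> False.
  by move=> xX yX; apply/negP; move/forall_inP: uX => /(_ x xX)/forall_inP; apply.
(* The chain of length zero counts, since [connect] is reflexive. *)
have no_rev x : x \in X -> rev_sep x \notin X.
  by move=> xX; apply/negP => /(no_chain x) -/(_ xX); apply; rewrite rev_sepK.
split.
- split=> // s Ss; case: (boolP (s \in X)) => sX.
    rewrite (_ : _ :&: _ = [set s]) ?cards1 //; apply/setP=> u; rewrite !inE.
    have [->|_] := eqVneq u s; first by rewrite sX.
    by have [->|_] := eqVneq u (rev_sep s); rewrite ?andbF // (negPf (no_rev s sX)).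
  have := maximal_orients X_max Ss; rewrite (negPf sX) /= => rsX.
  rewrite (_ : _ :&: _ = [set rev_sep s]) ?cards1 //; apply/setP=> u; rewrite !inE.
  have [->|_] := eqVneq u (rev_sep s); first by rewrite rsX orbT.
  by have [->|_] := eqVneq u s; rewrite ?andbF // (negPf sX).
- case=> r [s [Sr Ss _ [/andP[_ rs] rrX sX]]].
  by have := no_rev r (dX s r sX Sr rs); rewrite rrX.
(* A star of two elements would be a one-step chain, a singleton would have a small inverse, and the
   empty star would require [#|V| < k]. *)
move=> sigma sX [[_ [_ sig_star] sig_small]].
rewrite leq_eqVlt => /orP[/cards2P[r [s [rs def_sig]]]|].
  have rsig : r \in sigma by rewrite def_sig !inE eqxx.
  have ssig : s \in sigma by rewrite def_sig !inE eqxx orbT.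
  have [rX sX'] := (subsetP sX r rsig, subsetP sX s ssig).
  apply: (no_chain r s rX sX'); apply: connect1; apply/and4P.
  rewrite vecS_rev !(subsetP XS) // sig_star //; split=> //.
  by move: sig_small; rewrite def_sig big_setU1 ?inE // big_set1.
rewrite ltnS leq_eqVlt => /orP[/cards1P[s def_sig]|].
  have sX' : s \in X by rewrite (subsetP sX) // def_sig inE.
  have /negP[] := no_rev s sX'; apply: (subsetP smX).
  rewrite inE vecS_rev (subsetP XS) //=.
  by move: sig_small; rewrite def_sig big_set1.
rewrite ltnS leqn0 cards_eq0 => /eqP def_sig.
by move: sig_small; rewrite def_sig big_set0 cardsT ltnNge kV.
Qed.

Lemma tangle_of_unlinked : k <= #|V| -> unlinked small_seps ->
  exists O, tangle e k (Fk2 e k) O.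
Proof.
move=> kV u_small; have pre_small : pretangle small_seps.
  rewrite /pretangle subxx small_down_closed u_small !andbT.
  by apply/subsetP=> s; rewrite inE => /andP[].
by have [X X_max _] := maxset_exists pre_small; exists X; apply: maximal_tangle.
Qed.

(** * Trees from chains *)

Lemma vecS_neq_rev s : k <= #|V| -> s \in S -> s != rev_sep s.
Proof.
case: s => A B kV; rewrite in_vecS => /andP[/andP[/eqP/= AB _]].
apply: contraL => /eqP[eqAB _]; rewrite -leqNgt /order_sep /=.
by move: AB; rewrite eqAB setUid setIid => ->; rewrite cardsT.
Qed.

Lemma Fk2_set1 s : k <= #|V| -> s \in S -> #|s.2| < k -> Fk2 e k [set s].
Proof.
move=> kV Ss s_small; split; last by rewrite cards1.
split; last by rewrite big_set1.
  by rewrite sub1set; move: Ss; rewrite inE => /andP[].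
split=> [u /set1P->|u v /set1P-> /set1P->]; last by rewrite eqxx.
exact: vecS_neq_rev.
Qed.

Lemma Fk2_set2 r s : k <= #|V| -> follows r s -> Fk2 e k [set r; rev_sep s].
Proof.
move=> kV /and4P[Sr Ss rs bag]; have Srs : rev_sep s \in S by rewrite vecS_rev.
split; last by rewrite cards2 ltnS leq_b1.
split.
- by rewrite subUset !sub1set; move: Sr Srs; rewrite ![_ \in S]inE => /andP[-> _] /andP[].
- split=> [u /set2P[]->|u v /set2P[]-> /set2P[]->]; rewrite ?eqxx ?rev_sepK //.
  + exact: vecS_neq_rev.
  + exact: vecS_neq_rev.
  by rewrite le_rev_sep.
(* If the two elements coincide, the set is a singleton and the bag is just [r.2]. *)
have [eq_rs|neq] := eqVneq r (rev_sep s); last by rewrite big_setU1 ?inE // big_set1.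
by move: bag; rewrite eq_rs setUid big_set1 setIid.
Qed.

Definition path_graph n (i j : 'I_n) := (i.+1 == j) || (j.+1 == i).

Lemma path_graph_tree n : is_tree (@path_graph n.+1).
Proof.
have sym : symmetric (@path_graph n.+1) by move=> i j; rewrite /path_graph orbC.
split.
- by split=> // i; rewrite /path_graph orbb gtn_eqF.
- by rewrite card_ord.
- have conn0 (i : 'I_n.+1) : connect (@path_graph n.+1) ord0 i.
    case: i => i; elim: i => [|i IHi] lt_i.
      by rewrite (_ : Ordinal _ = ord0) //; apply: val_inj.
    apply: connect_trans (IHi (ltnW lt_i)) (connect1 _).
    by rewrite /path_graph eqxx.
  move=> i j; apply: connect_trans (conn0 j).
  by rewrite (sym_connect_sym sym) conn0.
(* Both neighbours on a cycle of its largest vertex [m] would be [m - 1]. *)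
move=> c c_gt2; apply/negP => /andP[cyc_c uniq_c].
have [x0 x0c] : exists x, x \in c by case: c c_gt2 {cyc_c uniq_c} => // x c; exists x; rewrite mem_head.
case: (arg_maxnP (fun i : 'I_n.+1 => i : nat) x0c) => m mc m_max.
have [i c' def_c] := rot_to mc.
have c'_max x : x \in m :: c' -> x <= m by rewrite -def_c mem_rot; apply: m_max.
move: cyc_c uniq_c c_gt2 c'_max.
rewrite -(rot_cycle i) -(rot_uniq i) -(size_rot i) def_c.
case/lastP: c' {def_c} => [//|[//|a c'] z]; rewrite /= rcons_path last_rcons.
case/and3P=> [ma _ zm] /and3P[_ a_notin _] _ c_max.
have max_adj y : y \in [:: m, a & rcons c' z] -> path_graph m y -> y.+1 = m.
  by move=> /c_max ym /orP[/eqP my|/eqP //]; move: ym; rewrite -my ltnn.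
have eq_az : a = z.
  apply/val_inj/succn_inj; rewrite !max_adj //; last by rewrite !inE eqxx orbT.
    by rewrite !inE mem_rcons mem_head !orbT.
  by rewrite sym.
by rewrite eq_az mem_rcons mem_head in a_notin.
Qed.

Lemma tree_of_chain x y : k <= #|V| -> x \in small_seps -> y \in small_seps ->
  connect follows x (rev_sep y) ->
  exists (T : finType) (t : rel T) (alpha : T -> T -> sep V),
    Sk_tree e k (Fk2 e k) t alpha.
Proof.
move=> kV; rewrite ![_ \in small_seps]inE => /andP[Sx x_small] /andP[Sy y_small].
case/connectP=> p xp last_p.
pose n := size p; pose q i := nth x (x :: p) i.
have q_step i : i < n -> follows (q i) (q i.+1) by move/(pathP x): xp; apply.
have Sq i : i <= n -> q i \in S.
  by case: i => [_|i /q_step/and4P[]//].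
have q_last : q n = rev_sep y by rewrite last_p /q -[RHS]/(last x (x :: p)) -nth_last.
(* The [n.+1] separations of the chain label the edges of a path on [n.+2] nodes: [q i] belongs to
   the edge from [i] to [i.+1]. *)
pose alpha (i j : 'I_n.+2) := if i < j then q i else rev_sep (q j).
have alpha_lt (i j : 'I_n.+2) : i.+1 = j -> alpha i j = q i by rewrite /alpha => <-; rewrite ltnSn.
have alpha_gt (i j : 'I_n.+2) : j.+1 = i -> alpha i j = rev_sep (q j).
  by rewrite /alpha => <-; rewrite ltnNge leqnSn.
exists 'I_n.+2; exists (@path_graph n.+2); exists alpha; split.
- exact: path_graph_tree.
- move=> i j /orP[/eqP ij|/eqP ji]; first by rewrite alpha_lt // Sq // -ltnS ij -ltnS.
  by rewrite alpha_gt // vecS_rev Sq // -ltnS ji -ltnS.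
- move=> i j /orP[/eqP ij|/eqP ji]; first by rewrite (alpha_lt i j) // (alpha_gt j i).
  by rewrite (alpha_lt j i) // (alpha_gt i j) // rev_sepK.
move=> j; have star_j s : (s \in [set alpha i j | i : 'I_n.+2 & path_graph i j])
    = (0 < j) && (s == q j.-1) || (j <= n) && (s == rev_sep (q j)).
  apply/imsetP/orP => [[i]|[/andP[j_gt0 /eqP->]|/andP[j_le /eqP->]]].
  - rewrite inE => /orP[/eqP ij|/eqP ji] ->.
      by left; rewrite alpha_lt // -ij eqxx.
    by right; rewrite alpha_gt // eqxx -ltnS -ltnS ji ltn_ord.
  - have lt_j : j.-1 < n.+2 by rewrite (leq_ltn_trans (leq_pred j)).
    exists (Ordinal lt_j); first by rewrite inE /path_graph /= prednK // eqxx.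
    by rewrite alpha_lt //= prednK.
  have lt_j : j.+1 < n.+2 by [].
  by exists (Ordinal lt_j); rewrite ?inE /path_graph /= ?eqxx ?orbT ?alpha_gt.
(* The end nodes carry [rev_sep x] and [rev_sep y], whose second sides [x.1] and [y.1] are small. At
   an inner node the intersection is the bag of two consecutive separations. *)
have [j0|j_gt0] := posnP j.
  rewrite (_ : [set _ | _ in _] = [set rev_sep x]); last first.
    by apply/setP=> s; rewrite star_j j0 inE.
  by apply: Fk2_set1; rewrite ?vecS_rev.
have [j_le|j_gt] := leqP j n; last first.
  have jn : j = n.+1 :> nat by apply/eqP; rewrite eqn_leq j_gt -ltnS ltn_ord.
  rewrite (_ : [set _ | _ in _] = [set rev_sep y]); last first.
    by apply/setP=> s; rewrite star_j jn ltnn orbF inE q_last.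
  by apply: Fk2_set1; rewrite ?vecS_rev.
rewrite (_ : [set _ | _ in _] = [set q j.-1; rev_sep (q j)]); last first.
  by apply/setP=> s; rewrite star_j j_gt0 j_le !inE.
by apply: Fk2_set2; rewrite // -{2}(prednK j_gt0) q_step // prednK.
Qed.

(** A single node suffices: its star is empty, with intersection [V]. The value [(set0, set0)] is a
    dummy, as there are no edges. *)
Lemma tree_of_small_graph : #|V| < k ->
  exists (T : finType) (t : rel T) (alpha : T -> T -> sep V),
    Sk_tree e k (Fk2 e k) t alpha.
Proof.
move=> Vk; exists 'I_1, (@path_graph 1), (fun _ _ => (set0, set0)).
have no_edge i j : @path_graph 1 i j = false by rewrite !ord1.
split=> [|i j|i j|j]; rewrite ?no_edge //; first exact: path_graph_tree.
rewrite (_ : [set _ | _ in _] = set0); last first.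
  by apply/setP=> s; rewrite inE; apply/imsetP=> -[i]; rewrite inE no_edge.
split; last by rewrite cards0.
split; [exact: sub0set | | by rewrite big_set0 cardsT].
by split=> [s|r s]; rewrite inE.
Qed.

Lemma tangle_or_tree : (exists O, tangle e k (Fk2 e k) O) \/
  exists (T : finType) (t : rel T) (alpha : T -> T -> sep V),
    Sk_tree e k (Fk2 e k) t alpha.
Proof.
have [kV|Vk] := leqP k #|V|; last by right; apply: tree_of_small_graph.
have [/(tangle_of_unlinked kV)|/unlinkedPn[x [y [xs ys xy]]]] := boolP (unlinked small_seps).
  by left.
by right; apply: tree_of_chain kV xs ys xy.
Qed.

End Graph.
End Separations.

(** * Tangles and trees exclude each other *)

Lemma acyclic_back_edge (T : finType) (t : rel T) (f : T -> T) :
  simple_graph t -> acyclic t -> 0 < #|T| -> (forall x, t x (f x)) ->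
  exists x, f (f x) = x.
Proof.
move=> [_ irr] acyc /card_gt0P[x _] tf.
(* Iterating [f] eventually loops, and the loop is a cycle of [t] with distinct vertices. Acyclicity
   bounds its length by two, and irreflexivity rules out length one. *)
have /trajectP[i lt_i def_i] := looping_order f x.
pose z := iter i f x; exists z.
have z_per : exists k, iter k.+1 f z = z.
  exists (order f x - i).-1; rewrite prednK ?subn_gt0 // /z -iterD subnK //.
  exact: ltnW.
have cyc_f : fcycle f (orbit f z) by apply/(orbitPcycle 3 0).
have cyc_t : cycle t (orbit f z).
  by apply: sub_cycle cyc_f => u v /eqP <-.
have := acyc (orbit f z); rewrite /ucycleb cyc_t orbit_uniq size_orbit.
move: cyc_f; rewrite /orbit; case def_o: (order f z) => [|[|[|m]]] //=.
- by have := order_gt0 f z; rewrite def_o.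
- by rewrite andbT => /eqP fz; have := tf z; rewrite fz irr.
- by rewrite andbT => /andP[_ /eqP].
by move=> _ /(_ isT).
Qed.

Lemma tangle_no_tree (V : finType) (e : rel V) (k : nat) (F : {set sep V} -> Prop)
    (O : {set sep V}) (T : finType) (t : rel T) (alpha : T -> T -> sep V) :
  (forall sigma, F sigma -> star sigma) ->
  tangle e k F O -> ~ Sk_tree e k F t alpha.
Proof.
move=> Fstar [[_ orO] _ avoid] [[simple_t T_gt0 _ acyc] Salpha alpha_rev Falpha].
have t_sym : symmetric t by case: simple_t.
have out x : exists y, t x y && (alpha x y \in O).
  have /subsetPn[s /imsetP[y tyx ->] yxO] : ~~ ([set alpha y x | y : T & t y x] \subset O).
    by apply/negP => /avoid; apply.
  rewrite inE in tyx; exists y; rewrite t_sym tyx (alpha_rev y x) //=.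
  have /eqP/cards1P[u def_u] := orO _ (Salpha y x tyx).
  have : u \in O :&: [set alpha y x; rev_sep (alpha y x)] by rewrite def_u set11.
  case/setIP=> uO /set2P[] def; last by rewrite -def.
  by rewrite -def uO in yxO.
pose f x := xchoose (out x).
have f_out x : t x (f x) && (alpha x (f x) \in O) by apply: (xchooseP (out x)).
have [|x ffx] := acyclic_back_edge simple_t acyc T_gt0 (f := f).
  by move=> x; case/andP: (f_out x).
have /andP[tx Ox] := f_out x; have := f_out (f x); rewrite ffx => /andP[_ Orx].
rewrite alpha_rev // in Orx.
(* Both orientations of this edge label lie in [O], which contains only one, so they are equal. A
   star has no element equal to its inverse. *)
have [neq _] := Fstar _ (Falpha (f x)).
have /neq : alpha x (f x) \in [set alpha y (f x) | y : T & t y (f x)].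
  by apply: imset_f; rewrite inE.
have := orO _ (Salpha x (f x) tx); move/eqP/cards1P=> [s def_s] /eqP; apply.
have in_s u : u \in O -> u \in [set alpha x (f x); rev_sep (alpha x (f x))] -> u = s.
  by move=> uO uS; apply/set1P; rewrite -def_s inE uO.
by rewrite (in_s _ Orx) ?set22 // (in_s _ Ox) ?set21.
Qed.

Theorem theorem7p1 (V : finType) (e : rel V) (k : nat)
    (graph_e : simple_graph e) (V_gt0 : 0 < #|V|) (k_gt0 : 0 < k) :
  let has_tangle :=
    exists O : {set sep V}, tangle e k (Fk2 e k) O in
  let has_tree :=
    exists (T : finType) (t : rel T) (alpha : T -> T -> sep V),
      Sk_tree e k (Fk2 e k) t alpha in
  (has_tangle /\ ~ has_tree) \/ (~ has_tangle /\ has_tree).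
Proof.
move=> has_tangle has_tree; have [e_sym _] := graph_e.
have excl : has_tangle -> ~ has_tree.
  by move=> [O tO] [T [t [alpha]]]; apply: tangle_no_tree tO => sigma [[]].
by have [tgl|tree] := tangle_or_tree k e_sym; [left | right]; split=> // /excl.
Qed.
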